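(* In three spacetime dimensions, let $\mathcal{B}_{(n)}$ be the order-$n$ term in the expansion in powers of the curvature of the Born–Infeld density $\sqrt{\det(\delta_a^b+G_a^b)}$, where $G_{ab}=R_{ab}-\frac12g_{ab}R$. Then $\mathcal{B}_{(1)}=\mathcal{C}_{(1)}$, $\mathcal{B}_{(2)}=\frac12\mathcal{C}_{(2)}$, $\mathcal{B}_{(3)}=-\frac18\mathcal{C}_{(3)}$, $\mathcal{B}_{(4)}=\frac1{16}\mathcal{C}_{(4)}$, $\mathcal{B}_{(5)}=-\frac5{128}\mathcal{C}_{(5)}$, and for every $n\ge6$ there is a density $\mathcal{L}_{(n-6)}$ of order $n-6$ such that $$\mathcal{B}_{(n)}=(-1)^n\frac{(2n-5)!!}{(2(n-1))!!}\,\mathcal{C}_{(n)}+\mathcal{Y}_{(6)}\cdot\mathcal{L}_{(n-6)},\qquad \mathcal{Y}_{(6)}=6\mathcal{S}_3^2-\mathcal{S}_2^3 .$$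
   Context: $R_{\langle ab\rangle}=R_{ab}-\frac13g_{ab}R$, $\mathcal{S}_2=R_{\langle a}{}^{b\rangle}R_{\langle b}{}^{a\rangle}$, $\mathcal{S}_3=R_{\langle a}{}^{b\rangle}R_{\langle b}{}^{c\rangle}R_{\langle c}{}^{a\rangle}$; densities of order $m$ are linear combinations of monomials $R^i\mathcal{S}_2^j\mathcal{S}_3^k$ with $i+2j+3k=m$. Explicitly, $\det(\delta_a^b+G_a^b)=1-\frac12R+\frac14\mathcal{T}_2+\frac1{24}\mathcal{T}_3$ with $\mathcal{T}_2=\frac13R^2-2\mathcal{S}_2$ and $\mathcal{T}_3=-\frac19R^3+2R\mathcal{S}_2+8\mathcal{S}_3$, and the square root is Taylor expanded. For $n\ge1$, $$\mathcal{C}_{(n)}=\frac{3(-1)^n}{4\cdot6^n n}\Big\{(R+\sqrt{24\mathcal{S}_2})^{n-1}\big(R-(n-1)\sqrt{24\mathcal{S}_2}\big)\big(1-\tfrac{\sqrt6\,\mathcal{S}_3}{\mathcal{S}_2^{3/2}}\big)+(R-\sqrt{24\mathcal{S}_2})^{n-1}\big(R+(n-1)\sqrt{24\mathcal{S}_2}\big)\big(1+\tfrac{\sqrt6\,\mathcal{S}_3}{\mathcal{S}_2^{3/2}}\big)\Big\},$$ which is a polynomial of order $n$ in $R,\mathcal{S}_2,\mathcal{S}_3$. *)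

(* Defs.v *)
From HB Require Import structures.
From mathcomp Require Import all_boot all_order all_algebra.
From mathcomp Require Import all_classical all_reals all_analysis.
Set Implicit Arguments.
Unset Strict Implicit.
Unset Printing Implicit Defensive.
Import Order.TTheory GRing.Theory Num.Theory.
Local Open Scope classical_set_scope.
Local Open Scope ring_scope.

(* The curvature at a point of a three-dimensional spacetime is given by the
   component matrices g_ab and R_ab of the metric and of the Ricci tensor in a
   basis of the tangent space.  No signature convention is imposed on g. *)
Definition is_metric (K : realType) (g : 'M[K]_3) : Prop :=
  g^T = g /\ g \in unitmx.

(* T_a^b = T_ac g^cb *)
Definition raise_index (K : realType) (g T : 'M[K]_3) : 'M[K]_3 :=
  T *m invmx g.

Definition scalar_curvature (K : realType) (g Ric : 'M[K]_3) : K :=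
  \tr (raise_index g Ric).

(* G_ab *)
Definition einstein (K : realType) (g Ric : 'M[K]_3) : 'M[K]_3 :=
  Ric - (scalar_curvature g Ric / 2) *: g.

(* R_<ab> *)
Definition traceless_ricci (K : realType) (g Ric : 'M[K]_3) : 'M[K]_3 :=
  Ric - (scalar_curvature g Ric / 3) *: g.

Definition S2 (K : realType) (g Ric : 'M[K]_3) : K :=
  let Z := raise_index g (traceless_ricci g Ric) in \tr (Z *m Z).

Definition S3 (K : realType) (g Ric : 'M[K]_3) : K :=
  let Z := raise_index g (traceless_ricci g Ric) in \tr (Z *m Z *m Z).

(* A density is represented as a function of the values r, s2, s3 of R, S2, S3.
   Each exponent of a monomial of order m is at most m, whence the ranges. *)
Definition density_of_order (K : realType) (m : nat) (F : K -> K -> K -> K) :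
    Prop :=
  exists c : nat -> nat -> nat -> K, forall r s2 s3 : K,
    F r s2 s3 =
      \sum_(i < m.+1) \sum_(j < m.+1)
        \sum_(k < m.+1 | (i + 2 * j + 3 * k == m)%N)
          c i j k * (r ^+ i * s2 ^+ j * s3 ^+ k).

Definition eval_density (K : realType) (F : K -> K -> K -> K)
    (g Ric : 'M[K]_3) : K :=
  F (scalar_curvature g Ric) (S2 g Ric) (S3 g Ric).

Definition born_infeld (K : realType) (g Ric : 'M[K]_3) : K :=
  Num.sqrt (\det (1%:M + raise_index g (einstein g Ric))).

(* B_(n): the n-th Taylor coefficient at t = 0 after rescaling the curvature
   R_ab to t R_ab at fixed metric. *)
Definition B_term (K : realType) (n : nat) (g Ric : 'M[K]_3) : K :=
  derive1n n (fun t : K => born_infeld g (t *: Ric)) 0 / n`!%:R.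

(* The expression defining C_(n); only meaningful for 0 < s2. *)
Definition C_expr (K : realType) (n : nat) (r s2 s3 : K) : K :=
  let s := Num.sqrt (24 * s2) in
  let q := Num.sqrt 6 * s3 / s2 `^ (3 / 2) in
  3 * (-1) ^+ n / (4 * 6 ^+ n * n%:R) *
    ((r + s) ^+ n.-1 * (r - n.-1%:R * s) * (1 - q)
     + (r - s) ^+ n.-1 * (r + n.-1%:R * s) * (1 + q)).

(* C_(n) as a density: the polynomial of order n given by C_expr wherever the
   latter makes sense.  It is unique, two polynomials that agree for all s2 > 0
   being equal; it also gives the value of C_(n) when S2 <= 0, which can happen
   for an indefinite metric. *)
Definition is_C (K : realType) (n : nat) (F : K -> K -> K -> K) : Prop :=
  density_of_order n F /\
  forall r s2 s3 : K, 0 < s2 -> F r s2 s3 = C_expr n r s2 s3.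

Fixpoint double_factorial (n : nat) : nat :=
  if n is n'.+2 then (n * double_factorial n')%N else 1%N.

Definition Y6 (K : realType) (g Ric : 'M[K]_3) : K :=
  6 * S3 g Ric ^+ 2 - S2 g Ric ^+ 3.

(* Main.v *)
Require Import Defs.
From HB Require Import structures.
From mathcomp Require Import all_boot all_order all_algebra.
From mathcomp Require Import all_classical all_reals all_analysis.
From mathcomp Require Import ring lra zify.
Set Implicit Arguments.
Unset Strict Implicit.
Unset Printing Implicit Defensive.
Import Order.TTheory GRing.Theory Num.Theory.
Import numFieldNormedType.Exports.
Local Open Scope ring_scope.

(* Put w = 24 S2 and tau = 288 S3, so that 13824 Y6 = tau^2 - w^3.  Up to a
   constant, C_(n) is a polynomial c_n in r, w, tau whose value at w = x^2,
   tau = - x^3 is T_n(x) = (r + x)^(n-1) (r - (n - 1) x).  At such points Y6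
   vanishes and the determinant, with the curvature rescaled by -6 y, is
   (1 + (r - x/2) y)^2 (1 + (r + x) y), whose square root has the Taylor
   coefficients binom(3/2, n) T_n(x): this is the claim modulo Y6.  To get hold
   of the cofactor of Y6 without dividing polynomials, compare recurrences.  The
   Taylor coefficients of the square root of a cubic satisfy a linear recurrence
   of order three; binom(3/2, n) c_n satisfies the same recurrence up to an
   explicit multiple of tau^2 - w^3, and the recurrence then defines the
   cofactor. *)

(** * Densities *)

Lemma eq_density (K : realType) (m : nat) (F G : K -> K -> K -> K) :
  (forall r s2 s3, G r s2 s3 = F r s2 s3) ->
  density_of_order m F -> density_of_order m G.
Proof. by move=> GF [c Fc]; exists c => r s2 s3; rewrite GF. Qed.

Lemma density0 (K : realType) (m : nat) :
  density_of_order m (fun _ _ _ : K => 0).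
Proof.
exists (fun _ _ _ => 0) => r s2 s3.
by do 3![rewrite big1 // => ? _]; rewrite mul0r.
Qed.

Lemma densityD (K : realType) (m : nat) (F G : K -> K -> K -> K) :
  density_of_order m F -> density_of_order m G ->
  density_of_order m (fun r s2 s3 => F r s2 s3 + G r s2 s3).
Proof.
move=> [c Fc] [d Gd]; exists (fun i j k => c i j k + d i j k) => r s2 s3.
rewrite Fc Gd; do 3![rewrite -big_split /=; apply: eq_bigr => ? _].
by rewrite mulrDl.
Qed.

Lemma densityZ (K : realType) (m : nat) (a : K) (F : K -> K -> K -> K) :
  density_of_order m F -> density_of_order m (fun r s2 s3 => a * F r s2 s3).
Proof.
move=> [c Fc]; exists (fun i j k => a * c i j k) => r s2 s3.
rewrite Fc; do 3![rewrite big_distrr /=; apply: eq_bigr => ? _].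
by rewrite mulrA.
Qed.

Lemma density_sum (K : realType) (m : nat) (I : Type) (l : seq I) (P : pred I)
    (F : I -> K -> K -> K -> K) :
  (forall i, P i -> density_of_order m (F i)) ->
  density_of_order m (fun r s2 s3 => \sum_(i <- l | P i) F i r s2 s3).
Proof.
move=> dF; elim: l => [|i l IHl].
  by apply: eq_density (density0 K m) => r s2 s3; rewrite big_nil.
case: (boolP (P i)) => [Pi|nPi].
  apply: eq_density (densityD (dF i Pi) IHl) => r s2 s3.
  by rewrite big_cons Pi.
by apply: eq_density IHl => r s2 s3; rewrite big_cons (negbTE nPi).
Qed.

Lemma density_monomial (K : realType) (i j k : nat) :
  density_of_order (i + 2 * j + 3 * k)
    (fun r s2 s3 : K => r ^+ i * s2 ^+ j * s3 ^+ k).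
Proof.
set m := (i + _ + _)%N.
exists (fun a b d => ((a == i) && (b == j) && (d == k))%:R) => r s2 s3.
have im : (i < m.+1)%N by rewrite /m; lia.
have jm : (j < m.+1)%N by rewrite /m; lia.
have km : (k < m.+1)%N by rewrite /m; lia.
rewrite (bigD1 (Ordinal im)) //= [X in _ + X]big1 => [|a /negbTE ai];
  last first.
  rewrite big1 // => b _; rewrite big1 // => d _.
  by rewrite -val_eqE /= in ai; rewrite ai mul0r.
rewrite (bigD1 (Ordinal jm)) //= [X in _ + X + _]big1 => [|b /negbTE bj];
  last first.
  rewrite big1 // => d _.
  by rewrite -val_eqE /= in bj; rewrite bj andbF mul0r.
rewrite (bigD1 (Ordinal km)) //= [X in _ + X + _ + _]big1
  => [|d /andP[_ /negbTE dk]]; last first.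
  by rewrite -val_eqE /= in dk; rewrite dk andbF mul0r.
by rewrite !eqxx mul1r !addr0.
Qed.

(** Closure under sums and scalars reduces this to products of monomials, whose exponents add; no
    coefficients of the product are written down. *)
Lemma densityM (K : realType) (m n : nat) (F G : K -> K -> K -> K) :
  density_of_order m F -> density_of_order n G ->
  density_of_order (m + n) (fun r s2 s3 => F r s2 s3 * G r s2 s3).
Proof.
move=> [c Fc] [d Gd].
have dG (i j k : nat) (Hm : (i + 2 * j + 3 * k)%N = m) :
    density_of_order (m + n) (fun r s2 s3 =>
      r ^+ i * s2 ^+ j * s3 ^+ k * G r s2 s3).
  pose T (u : 'I_n.+1 * ('I_n.+1 * 'I_n.+1)) r s2 s3 := d u.1 u.2.1 u.2.2 *
     (r ^+ (i + u.1) * s2 ^+ (j + u.2.1) * s3 ^+ (k + u.2.2)) : K.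
  apply: (@eq_density _ _ (fun r s2 s3 => \sum_(a < n.+1) \sum_(b < n.+1)
     \sum_(e < n.+1 | (a + 2 * b + 3 * e == n)%N) T (a, (b, e)) r s2 s3)).
    move=> r s2 s3; rewrite Gd.
    do 3![rewrite big_distrr /=; apply: eq_bigr => ? _].
    by rewrite /T /= !exprD; ring.
  apply: density_sum => a _; apply: density_sum => b _.
  apply: density_sum => e /eqP abe; apply: densityZ => /=.
  have -> : (m + n = i + a + 2 * (j + b) + 3 * (k + e))%N by lia.
  exact: density_monomial.
apply: (@eq_density _ _ (fun r s2 s3 => \sum_(a < m.+1) \sum_(b < m.+1)
     \sum_(e < m.+1 | (a + 2 * b + 3 * e == m)%N)
        c a b e * (r ^+ a * s2 ^+ b * s3 ^+ e * G r s2 s3))).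
  move=> r s2 s3; rewrite Fc.
  by do 3![rewrite big_distrl /=; apply: eq_bigr => ? _]; rewrite -mulrA.
do 2![apply: density_sum => ? _]; apply: density_sum => e /eqP Hn.
exact/densityZ/dG.
Qed.

Lemma density_const (K : realType) (a : K) :
  density_of_order 0 (fun _ _ _ => a).
Proof.
apply: eq_density (densityZ a (density_monomial K 0 0 0)) => r s2 s3.
by rewrite !expr0 !mulr1.
Qed.

Lemma density_r (K : realType) : density_of_order 1 (fun r _ _ : K => r).
Proof.
apply: eq_density (density_monomial K 1 0 0) => r s2 s3.
by rewrite !expr0 !mulr1.
Qed.

Lemma density_s2 (K : realType) : density_of_order 2 (fun _ s2 _ : K => s2).
Proof.
apply: eq_density (density_monomial K 0 1 0) => r s2 s3.
by rewrite !expr0 mulr1 mul1r.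
Qed.

Lemma density_s3 (K : realType) : density_of_order 3 (fun _ _ s3 : K => s3).
Proof.
apply: eq_density (density_monomial K 0 0 1) => r s2 s3.
by rewrite !expr0 !mul1r.
Qed.

(* Density of order m - k, where a negative order means the zero density. *)
Definition density_from (K : realType) (k m : nat) (F : K -> K -> K -> K) :
    Prop :=
  if (k <= m)%N then density_of_order (m - k) F
  else forall r s2 s3, F r s2 s3 = 0.

Lemma eq_density_from (K : realType) (k m : nat) (F G : K -> K -> K -> K) :
  (forall r s2 s3, G r s2 s3 = F r s2 s3) ->
  density_from k m F -> density_from k m G.
Proof.
rewrite /density_from => GF; case: ifP => _ dF; first exact: eq_density dF.
by move=> r s2 s3; rewrite GF.
Qed.

Lemma density_from0 (K : realType) (k m : nat) :
  density_from k m (fun _ _ _ : K => 0).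
Proof. by rewrite /density_from; case: ifP => // _; apply: density0. Qed.

Lemma density_fromD (K : realType) (k m : nat) (F G : K -> K -> K -> K) :
  density_from k m F -> density_from k m G ->
  density_from k m (fun r s2 s3 => F r s2 s3 + G r s2 s3).
Proof.
rewrite /density_from; case: ifP => _ dF dG; first exact: densityD.
by move=> r s2 s3; rewrite dF dG addr0.
Qed.

Lemma density_fromM (K : realType) (j k m : nat) (F G : K -> K -> K -> K) :
  density_of_order j F -> density_from k m G ->
  density_from k (j + m) (fun r s2 s3 => F r s2 s3 * G r s2 s3).
Proof.
rewrite /density_from => dF; case: (leqP k m) => [km dG|_ G0].
  by rewrite (leq_trans km (leq_addl _ _)) -addnBA //; apply: densityM.
(* Here m < k, so [G] vanishes; the product is zero, and zero is a density of every order, also when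
   k <= j + m. *)
case: ifP => _; last by move=> r s2 s3; rewrite G0 mulr0.
by apply: eq_density (density0 K _) => r s2 s3; rewrite G0 mulr0.
Qed.

Lemma density_fromZ (K : realType) (k m : nat) (a : K) (F : K -> K -> K -> K) :
  density_from k m F -> density_from k m (fun r s2 s3 => a * F r s2 s3).
Proof. exact: density_fromM (density_const a). Qed.

(** Only the difference of the two indices matters. Read from right to left, it raises both so that
    factors of different orders can be combined. *)
Lemma density_from_shift (K : realType) (j k m : nat) (F : K -> K -> K -> K) :
  density_from (j + k) (j + m) F = density_from k m F.
Proof. by rewrite /density_from leq_add2l subnDl. Qed.

Lemma density_from_order (K : realType) (k m : nat) (F : K -> K -> K -> K) :
  density_from k (k + m) F -> density_of_order m F.
Proof. by rewrite /density_from leq_addr addKn. Qed.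

(** * Derivatives of the square root of a cubic *)

(* The n-th derivative of p^(1/2) is [sqrt_deriv_num p n] p^(1/2 - n). *)
Fixpoint sqrt_deriv_num (K : realType) (p : {poly K}) (n : nat) : {poly K} :=
  if n is m.+1 then
    p * (sqrt_deriv_num p m)^`()
    + ((2^-1)%:P - m%:R) * p^`() * sqrt_deriv_num p m
  else 1.

(** Differentiating q p^(1/2 - n) gives (p q' + (1/2 - n) p' q) p^(1/2 - (n + 1)), which is the
    recursion of [sqrt_deriv_num]. *)
Lemma derive1n_sqrt_horner (K : realType) (p : {poly K}) (n : nat) (t : K) :
  0 < p.[t] ->
  derive1n n (fun u : K => Num.sqrt p.[u]) t
  = (sqrt_deriv_num p n).[t] * (Num.sqrt p.[t] / p.[t] ^+ n).
Proof.
elim: n t => [|n IHn] t pt_gt0; first by rewrite /= hornerC mul1r expr0 divr1.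
rewrite derive1nS derive1E.
(* The induction hypothesis is available only where p > 0; this holds near t, which suffices for
   differentiating at t. *)
have near_pos : \forall u \near nbhs t, 0 < p.[u].
  apply: (cvgr_gt p.[t]) pt_gt0.
  apply: differentiable_continuous; exact/derivable1_diffP/derivable_horner.
rewrite (@near_eq_derive _ _ _ _
    (fun u => (sqrt_deriv_num p n).[u] * (Num.sqrt p.[u] / p.[u] ^+ n)));
  last by near=> u; apply: IHn; near: u.
have ptn0 : p.[t] != 0 by rewrite gt_eqF.
have dp := is_derive_poly p t.
have ds := is_derive1_comp (is_derive1_sqrt pt_gt0) dp.
have ptn_n0 : (p ^+ n).[t] != 0 by rewrite horner_exp expf_neq0.
have dV := is_deriveV ptn_n0 (is_derive_poly (p ^+ n) t).
have dM := is_deriveM (is_derive_poly (sqrt_deriv_num p n) t)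
  (is_deriveM ds dV).
have -> : (fun u => (sqrt_deriv_num p n).[u] * (Num.sqrt p.[u] / p.[u] ^+ n))
  = horner (sqrt_deriv_num p n)
    * ((Num.sqrt \o horner p) * (fun u => (p ^+ n).[u]^-1)).
  by apply/funext => u; rewrite /= !fctE /= horner_exp.
rewrite (@derive_val _ _ _ _ _ _ _ dM) /= !fctE /= deriv_exp.
have s2 : Num.sqrt p.[t] ^+ 2 = p.[t] by rewrite sqr_sqrtr // ltW.
have sV : (2 * Num.sqrt p.[t])^-1 = Num.sqrt p.[t] / (2 * p.[t]).
  have s_n0 : Num.sqrt p.[t] != 0 by rewrite sqrtr_eq0 -ltNge.
  move: s2 s_n0; move: (Num.sqrt _) => s <- s_n0; field.
  exact: s_n0.
have nV : p.[t] ^+ n.-1 *+ n / p.[t] ^+ n ^+ 2 = n%:R / (p.[t] ^+ n * p.[t]).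
  (* The derivative of p^n carries the exponent [n.-1], so n = 0 is treated apart. *)
  case: n {IHn dV dM ptn_n0} => [|n] /=; first by rewrite !mul0r.
  rewrite -mulr_natr (exprSr p.[t] n).
  have := expf_neq0 n ptn0; move: (p.[t] ^+ n) => y y_n0.
  by field; rewrite ptn0 y_n0.
rewrite !(hornerE, horner_exp) -polyC_natr hornerC hornerMn hornerM horner_exp.
rewrite sV (exprSr p.[t] n); set s := Num.sqrt _ in s2 sV *.
have -> (a b c d e : K) : a *: (s *: (- b *: (c * d *+ n)) + e)
    = a * (e - s * c * (d *+ n * b)) by rewrite /GRing.scale /=; ring.
rewrite nV /GRing.scale /=.
have := expf_neq0 n ptn0; move: (p.[t] ^+ n) => y y_n0.
by field; rewrite ptn0 y_n0.
Unshelve. all: by end_near.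
Qed.

(* Leibniz' rule applied n + 2 times to 2 p f' = p' f, for f^2 = p. *)
Lemma sqrt_deriv_num_rec (K : realType) (p : {poly K}) (n : nat) :
  p^`()^`()^`()^`() = 0 ->
  12 * (sqrt_deriv_num p n.+2)^`() =
  - (6 * n.+2%:R * n%:R * p^`()^`() * sqrt_deriv_num p n.+1)
  - n.+2%:R * n.+1%:R * (2 * n%:R - 3) * p^`()^`()^`() * p
    * sqrt_deriv_num p n.
Proof.
move=> p4.
have h2 : 2 * (2^-1)%:P = 1 :> {poly K}.
  by rewrite -[2 in LHS]polyC_natr -polyCM divff ?pnatr_eq0.
have dn m : (m%:R : {poly K})^`() = 0 by rewrite -polyC_natr derivC.
have da : ((2^-1)%:P : {poly K})^`() = 0 by rewrite derivC.
have d1 : (1 : {poly K})^`() = 0 := dn 1.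
have d0 : (0 : {poly K})^`() = 0 := dn 0.
set a := (2^-1)%:P in h2 da.
elim: n => [|n IHn].
  rewrite /= -/a !(d1, dn, da, d0, derivM, derivD, derivB, derivN).
  rewrite !(mulr0, mul0r, subr0, add0r, addr0, mulr1, oppr0).
  rewrite ?(d1, dn, da, d0, derivM, derivD, derivB, derivN).
  transitivity (6 * ((2 * a) * (2 * a) * p^`() * p^`()^`()
      - 2 * a * p^`() * p^`()^`() + 2 * a * p * p^`()^`()^`())).
    by ring.
  by rewrite h2; ring.
move: IHn.
(* The definition of [sqrt_deriv_num], read backwards, eliminates a first derivative once it is
   multiplied by p. *)
have : p * (sqrt_deriv_num p n.+1)^`() = sqrt_deriv_num p n.+2
    - (a - n.+1%:R) * p^`() * sqrt_deriv_num p n.+1.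
  by rewrite /= addrK.
have : p * (sqrt_deriv_num p n)^`() = sqrt_deriv_num p n.+1
    - (a - n%:R) * p^`() * sqrt_deriv_num p n.
  by rewrite /= addrK.
have -> : sqrt_deriv_num p n.+3 = p * (sqrt_deriv_num p n.+2)^`()
    + (a - n.+2%:R) * p^`() * sqrt_deriv_num p n.+2 by [].
move: (sqrt_deriv_num p n) (sqrt_deriv_num p n.+1) (sqrt_deriv_num p n.+2)
  => Q0 Q1 Q2 E1 E2 IHn.
(* The differentiated induction hypothesis; since p'''' = 0, the factor p''' behaves as a
   constant. *)
have dIH : 12 * Q2^`()^`() =
    - (6 * n.+2%:R * n%:R * (p^`()^`()^`() * Q1 + p^`()^`() * Q1^`()))
    - n.+2%:R * n.+1%:R * (2 * n%:R - 3) * p^`()^`()^`()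
      * (p^`() * Q0 + p * Q0^`()).
  have H := congr1 (@deriv K) IHn.
  rewrite !(d1, dn, p4, derivM, derivD, derivB, derivN) in H.
  by apply: (eq_trans (eq_trans _ H)); ring.
rewrite !(dn, da, derivM, derivD, derivN).
have N1 : n.+1%:R = n%:R + 1 :> {poly K} by rewrite natr1.
have N2 : n.+2%:R = n%:R + 1 + 1 :> {poly K} by rewrite !natr1.
have N3 : n.+3%:R = n%:R + 1 + 1 + 1 :> {poly K} by rewrite !natr1.
rewrite N1 N2 N3; rewrite N1 N2 in dIH IHn; rewrite N1 in E2.
clearbody a.
transitivity (p * (12 * Q2^`()^`()) + (a - n%:R - 1) * p^`() * (12 * Q2^`())
  + 6 * (2 * a - 2 * n%:R - 4) * p^`()^`() * Q2); first by ring.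
rewrite dIH IHn h2.
transitivity (- (6 * (n%:R + 1 + 1) * n%:R
      * (p^`()^`()^`() * p * Q1 + p^`()^`() * (p * Q1^`())))
    - (n%:R + 1 + 1) * (n%:R + 1) * (2 * n%:R - 3) * p^`()^`()^`()
      * (p * p^`() * Q0 + p * (p * Q0^`()))
  - (a - n%:R - 1) * p^`() * (6 * (n%:R + 1 + 1) * n%:R * p^`()^`() * Q1
    + (n%:R + 1 + 1) * (n%:R + 1) * (2 * n%:R - 3) * p^`()^`()^`() * p * Q0)
  + 6 * (1 - 2 * n%:R - 4) * p^`()^`() * Q2); first by ring.
rewrite E1 E2; ring.
Qed.

(** The cubic is 1 at 0, so b n is the value of [sqrt_deriv_num] at 0 over n!, and
    [sqrt_deriv_num_rec] evaluated at 0 is the recurrence up to factorials. *)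
Lemma taylor_sqrt_cubic (K : realType) (f : K -> K) (p1 p2 p3 : K) :
  (forall t, f t = Num.sqrt (1 + p1 * t + p2 * t ^+ 2 + p3 * t ^+ 3)) ->
  let b n := derive1n n f 0 / n`!%:R in
  [/\ b 0%N = 1, b 1%N = p1 / 2, b 2%N = p2 / 2 - p1 ^+ 2 / 8
    & forall n, 2 * (n%:R + 3) * b n.+3 = - (2 * n%:R + 3) * p1 * b n.+2
        - 2 * n%:R * p2 * b n.+1 - (2 * n%:R - 3) * p3 * b n].
Proof.
move=> fE.
pose p : {poly K} := 1 + 'X * (p1%:P + 'X * (p2%:P + p3%:P * 'X)).
have -> : f = fun t => Num.sqrt p.[t].
  apply/funext => t; rewrite fE /p !(hornerD, hornerM, hornerX, hornerC).
  by congr Num.sqrt; ring.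
have p0 : p.[0] = 1 by rewrite /p !(hornerD, hornerM, hornerX, hornerC); ring.
have dp0 : p^`().[0] = p1.
  rewrite /p !(derivC, derivX, derivM, derivD).
  by rewrite !(hornerD, hornerM, hornerX, hornerC); ring.
have ddp0 : p^`()^`().[0] = 2 * p2.
  rewrite /p !(derivC, derivX, derivM, derivD).
  by rewrite !(hornerD, hornerM, hornerX, hornerC); ring.
have dddp0 : p^`()^`()^`().[0] = 6 * p3.
  rewrite /p !(derivC, derivX, derivM, derivD).
  by rewrite !(hornerD, hornerM, hornerX, hornerC); ring.
have p4 : p^`()^`()^`()^`() = 0.
  rewrite /p !(derivC, derivX, derivM, derivD); ring.
clearbody p; move=> b; pose Q n := (sqrt_deriv_num p n).[0].
have bE n : b n = Q n / n`!%:R.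
  by rewrite /b derive1n_sqrt_horner p0 // sqrtr1 expr1n divr1 mulr1.
have QS n : Q n.+1 = (sqrt_deriv_num p n)^`().[0] + (2^-1 - n%:R) * p1 * Q n.
  rewrite /Q /= !(hornerD, hornerM, hornerN) p0 dp0 mul1r.
  by rewrite -polyC_natr !hornerC.
have Q0 : Q 0%N = 1 by rewrite /Q /= hornerC.
have Q1 : Q 1%N = p1 / 2.
  by rewrite QS Q0 /= derivC hornerC; field.
have Q2 : Q 2%N = p2 - p1 ^+ 2 / 4.
  rewrite QS Q1 /= derivC mulr0 add0r subr0 mulr1 derivM derivC mul0r add0r.
  by rewrite hornerM hornerC ddp0; field.
split; rewrite ?bE ?Q0 ?Q1 ?Q2.
- by rewrite divr1.
- by rewrite divr1.
- by have -> : 2`! = 2%N by []; field.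
move=> n; rewrite !bE QS.
have := sqrt_deriv_num_rec n p4; rewrite /Q.
move: (sqrt_deriv_num p n.+2)
  (sqrt_deriv_num p n.+1) (sqrt_deriv_num p n) => q2 q1 q0.
move=> /(congr1 (horner^~ 0)) /=.
rewrite -!polyC_natr !(hornerM, hornerD, hornerN, hornerC) ddp0 dddp0 p0.
move: q2^`().[0] q2.[0] q1.[0] q0.[0] => dc c2 c1 c0 H.
have -> : dc = (12 * dc) / 12 by field.
rewrite H !factS !natrM.
have n1 : n.+1%:R = n%:R + 1 :> K by rewrite natr1.
have n2 : n.+2%:R = n%:R + 1 + 1 :> K by rewrite !natr1.
have n3 : n.+3%:R = n%:R + 1 + 1 + 1 :> K by rewrite !natr1.
have : n`!%:R != 0 :> K by rewrite pnatr_eq0 -lt0n fact_gt0.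
rewrite n1 n2 n3; have : 0 <= n%:R :> K by apply: ler0n.
move: (n%:R : K) (n`!%:R : K) => N F N_ge0 F_neq0.
by field; rewrite F_neq0 /=; apply/and3P; split; lra.
Qed.

(** * The densities C_(n) and the cofactor of Y6 *)

(* (r + x)^n = [evenp r (x^2) n] + x [oddp r (x^2) n]. *)
Fixpoint evenp (K : realType) (r w : K) (n : nat) : K :=
  if n is m.+1 then r * evenp r w m + w * oddp r w m else 1
with oddp (K : realType) (r w : K) (n : nat) : K :=
  if n is m.+1 then evenp r w m + r * oddp r w m else 0.

(* The quotient by w in [oddqE] below. *)
Fixpoint oddq (K : realType) (r w : K) (n : nat) : K :=
  if n is m.+1 then r * oddq r w m - m.+1%:R * oddp r w m else 0.

(** The right side is the odd part, divided by x, of (r + x)^n (r - n x) with w = x^2. Its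
    divisibility by w is why C_(n) is a polynomial despite the denominator S2^(3/2). *)
Lemma oddqE (K : realType) (r w : K) (n : nat) :
  w * oddq r w n = r * oddp r w n - n%:R * evenp r w n.
Proof.
elim: n => [|n IHn] /=; first by ring.
by rewrite mulrBr mulrCA IHn -natr1; ring.
Qed.

(* At tau = - x^3 and w = x^2 this is (r + x)^n (r - n x); it is C_(n+1) up to a
   constant factor. *)
Definition cpoly (K : realType) (r w tau : K) (n : nat) : K :=
  r * evenp r w n - n%:R * w * oddp r w n - tau * oddq r w n.

(** This is the recurrence of [taylor_sqrt_cubic], shifted by one, for (- 1/6)^(m+1) binom(3/2, m+1)
    c_m, with powers of - 1/6 and the common factor binom(3/2, n+2) / (2 (n + 3)) cleared. The right
    side is the defect. *)
Lemma cpoly_rec (K : realType) (r w tau : K) (n : nat) :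
  let c := cpoly r w tau in let N : K := n%:R in
  (2 * N + 1) * ((2 * N + 3) * c n.+3 - 3 * r * (2 * N + 5) * c n.+2)
  + 4 * (N + 3) * (N + 1) * (3 * r ^+ 2 - 3 / 4 * w) * c n.+1
  - 4 * (N + 3) * (N + 2) * (r ^+ 3 - 3 / 4 * r * w - tau / 4) * c n
  = - (N + 3) * (N + 2) * (tau ^+ 2 - w ^+ 3) * oddq r w n.
Proof.
move=> c N; rewrite /c /cpoly /= -!natr1 -/N.
have Hq := oddqE r w n; rewrite -/N in Hq.
move: Hq; move: (evenp r w n) (oddp r w n) (oddq r w n) N => A B O N Hq.
(* The multiplier of [oddqE] is read off the coefficient of [oddq r w n]. *)
apply: subr0_eq; transitivity
  (- (N + 3) * (3 * tau * r + (N + 2) * w ^+ 2) * (w * O - (r * B - N * A))).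
  by field.
by rewrite Hq subrr mulr0.
Qed.

(* The generalized binomial coefficient binom(3/2, n). *)
Fixpoint binom32 (K : realType) (n : nat) : K :=
  if n is m.+1 then binom32 K m * (3 / 2 - m%:R) / m.+1%:R else 1.

Lemma binom32S (K : realType) (n : nat) :
  binom32 K n.+1 = binom32 K n * (3 / 2 - n%:R) / n.+1%:R.
Proof. by []. Qed.

(* Indexed like [cpoly]: entry n has order n + 1 - 6. *)
Fixpoint cofactor6 (K : realType) (r w tau : K) (n : nat) : K :=
  match n with
  | (((m.+1) as m1).+1 as m2).+1 =>
      ((m.+2%:R / 2 * binom32 K m.+2) * oddq r w m
       - (2 * m%:R + 5) * (3 * r * cofactor6 r w tau m2)
       - (2 * m%:R + 2)
         * ((3 * r ^+ 2 - 3 / 4 * w) * cofactor6 r w tau m1)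
       - (2 * m%:R - 1)
         * ((r ^+ 3 - 3 / 4 * r * w - tau / 4) * cofactor6 r w tau m))
      / (2 * m%:R + 8)
  | _ => 0
  end.

Lemma cofactor6SSS (K : realType) (r w tau : K) (m : nat) :
  cofactor6 r w tau m.+3 =
      ((m.+2%:R / 2 * binom32 K m.+2) * oddq r w m
       - (2 * m%:R + 5) * (3 * r * cofactor6 r w tau m.+2)
       - (2 * m%:R + 2)
         * ((3 * r ^+ 2 - 3 / 4 * w) * cofactor6 r w tau m.+1)
       - (2 * m%:R - 1)
         * ((r ^+ 3 - 3 / 4 * r * w - tau / 4) * cofactor6 r w tau m))
      / (2 * m%:R + 8).
Proof. by []. Qed.

(** * Orders of C_(n) and of the cofactor *)

(** With x of order 1, (r + x)^n is homogeneous of order n, and the odd part loses one order when x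
    is factored out. It is zero for n = 0, where that order would be negative. *)
Lemma density_evenp_oddp (K : realType) (n : nat) :
  density_from 0 n (fun r s2 s3 : K => evenp r (24 * s2) n) /\
  density_from 1 n (fun r s2 s3 : K => oddp r (24 * s2) n).
Proof.
elim: n => [|n [IHe IHo]].
  by split; [apply: density_const | apply: density_from0].
split.
  apply: (@density_fromD K 0 n.+1 (fun r s2 _ => r * evenp r (24 * s2) n)
    (fun r s2 _ => 24 * s2 * oddp r (24 * s2) n)).
    exact: density_fromM (density_r K) IHe.
  rewrite -(density_from_shift 1).
  exact: density_fromM (densityZ 24 (density_s2 K)) IHo.
apply: (@density_fromD K 1 n.+1 (fun r s2 _ => evenp r (24 * s2) n)
  (fun r s2 _ => r * oddp r (24 * s2) n)).
  by rewrite -(density_from_shift 1) in IHe.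
exact: density_fromM (density_r K) IHo.
Qed.

(** The order is n - 2, as [oddqE] suggests. The form n + 1 - 3 fits [cpoly], where a factor tau of
    order 3 brings it to n + 1. *)
Lemma density_oddq (K : realType) (n : nat) :
  density_from 3 n.+1 (fun r s2 s3 : K => oddq r (24 * s2) n).
Proof.
elim: n => [|n IHn]; first exact: density_from0.
have [_ dO] := density_evenp_oddp K n.
apply: (@eq_density_from K 3 n.+2 (fun r s2 _ => r * oddq r (24 * s2) n
  + - n.+1%:R * oddp r (24 * s2) n)).
  by move=> r s2 _; rewrite /= mulNr.
apply: density_fromD; first exact: density_fromM (density_r K) IHn.
by apply: density_fromZ; rewrite -(density_from_shift 2) in dO.
Qed.

Lemma density_cpoly (K : realType) (n : nat) :
  density_of_order n.+1
    (fun r s2 s3 : K => cpoly r (24 * s2) (288 * s3) n).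
Proof.
have [dE dO] := density_evenp_oddp K n; have dQ := density_oddq K n.
apply: (@density_from_order K 0).
apply: (@eq_density_from K 0 n.+1 (fun r s2 s3 => r * evenp r (24 * s2) n
  + (- n%:R * ((24 * s2) * oddp r (24 * s2) n)
     + -1 * (288 * s3 * oddq r (24 * s2) n)))).
  by move=> r s2 s3; rewrite /cpoly; ring.
apply: density_fromD; first exact: density_fromM (density_r K) dE.
apply: density_fromD; apply: density_fromZ.
  rewrite -(density_from_shift 1).
  exact: density_fromM (densityZ 24 (density_s2 K)) dO.
rewrite -(density_from_shift 3).
exact: density_fromM (densityZ 288 (density_s3 K)) dQ.
Qed.

Lemma density_cofactor6 (K : realType) (n : nat) :
  density_from 6 n.+1
    (fun r s2 s3 : K => cofactor6 r (24 * s2) (288 * s3) n).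
Proof.
pose D n := density_from 6 n.+1
    (fun r s2 s3 : K => cofactor6 r (24 * s2) (288 * s3) n).
(* The recurrence has order three, so the induction carries three consecutive indices. *)
suff [] : [/\ D n, D n.+1 & D n.+2] by [].
elim: n => [|n [D0 D1 D2]]; first by split; apply: density_from0.
split=> //; have dQ := density_oddq K n.
have d2 : density_of_order 2
    (fun r s2 s3 : K => 3 * r ^+ 2 - 3 / 4 * (24 * s2)).
  apply: eq_density (densityD
    (densityZ 3 (densityM (density_r K) (density_r K)))
    (densityZ (-18) (density_s2 K))) => r s2 s3.
  by field.
have d3 : density_of_order 3
    (fun r s2 s3 : K => r ^+ 3 - 3 / 4 * r * (24 * s2) - 288 * s3 / 4).
  apply: eq_density (densityD
    (densityM (density_r K) (densityM (density_r K) (density_r K)))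
    (densityD (densityZ (-18) (densityM (density_r K) (density_s2 K)))
      (densityZ (-72) (density_s3 K)))) => r s2 s3.
  by field.
have E0 := density_fromM d3 D0.
have E1 := density_fromM d2 D1.
have E2 := density_fromM (densityZ 3 (density_r K)) D2.
(* The source term has order n + 1 - 3 = n + 4 - 6, like the three other terms. *)
rewrite -(density_from_shift 3) in dQ.
apply: eq_density_from (density_fromZ (2 * n%:R + 8)^-1 (density_fromD
  (density_fromD (density_fromZ (n.+2%:R / 2 * binom32 K n.+2) dQ)
    (density_fromZ (- (2 * n%:R + 5)) E2))
  (density_fromD (density_fromZ (- (2 * n%:R + 2)) E1)
    (density_fromZ (- (2 * n%:R - 1)) E0)))).
move=> r s2 s3; rewrite cofactor6SSS; ring.
Qed.

(** * Comparison of the two recurrences *)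

(** Both sides obey the same recurrence of order three: the defect in [cpoly_rec] is compensated by
    the source term of [cofactor6]. The powers of - 1/6 undo the rescaling t = - 6 y of the
    cubic. *)
Lemma sqrt_coef_eq (K : realType) (r w tau : K) (b : nat -> K) :
  let p1 := - r / 2 in let p2 := (3 * r ^+ 2 - 3 / 4 * w) / 36 in
  let p3 := - (r ^+ 3 - 3 / 4 * r * w - tau / 4) / 216 in
  b 0%N = 1 -> b 1%N = p1 / 2 -> b 2%N = p2 / 2 - p1 ^+ 2 / 8 ->
  (forall n, 2 * (n%:R + 3) * b n.+3 = - (2 * n%:R + 3) * p1 * b n.+2
     - 2 * n%:R * p2 * b n.+1 - (2 * n%:R - 3) * p3 * b n) ->
  forall n, b n.+1 = (- 6^-1) ^+ n.+1 * (binom32 K n.+1 * cpoly r w tau n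
     + (tau ^+ 2 - w ^+ 3) * cofactor6 r w tau n).
Proof.
move=> p1 p2 p3 b0 b1 b2 brec.
pose P n := b n.+1 = (- 6^-1) ^+ n.+1 * (binom32 K n.+1 * cpoly r w tau n
     + (tau ^+ 2 - w ^+ 3) * cofactor6 r w tau n).
move=> n; suff [] : [/\ P n, P n.+1 & P n.+2] by [].
elim: n => [|n [P0 P1 P2]].
  (* The cofactors at 0, 1, 2 are zero by definition, so these three identities are exact; b 3 comes
     from the recurrence at 0, where its coefficient is 6. *)
  split; rewrite /P.
  - by rewrite b1 /p1 /cpoly /=; field.
  - by rewrite b2 /p1 /p2 /cpoly /=; field.
  - have := brec 0%N; rewrite b0 b1 b2 => b3.
    have -> : b 3 = (2 * (0%:R + 3) * b 3) / 6 by rewrite mulr0n; field.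
    by rewrite b3 /p1 /p2 /p3 /cpoly /=; field.
split=> //; rewrite /P.
have n_ge0 : 0 <= n%:R :> K := ler0n K n.
have n1 : n.+1%:R = n%:R + 1 :> K by rewrite natr1.
have n2 : n.+2%:R = n%:R + 1 + 1 :> K by rewrite !natr1.
have n3 : n.+3%:R = n%:R + 1 + 1 + 1 :> K by rewrite !natr1.
have n4 : n.+4%:R = n%:R + 1 + 1 + 1 + 1 :> K by rewrite !natr1.
have Hc := cpoly_rec r w tau n; rewrite /= in Hc.
have Hb := brec n.+1.
(* All binomials are expressed through [binom32 K n.+2]. The factor 2 n - 1 stays on the left
   because it is the coefficient of b n.+1, up to p3, in the recurrence. *)
have H2 : (2 * n%:R - 1) * binom32 K n.+1
    = - 2 * (n%:R + 2) * binom32 K n.+2.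
  rewrite [binom32 K n.+2]binom32S n1 n2; field; lra.
have H3 : binom32 K n.+3
    = - (2 * n%:R + 1) / (2 * (n%:R + 3)) * binom32 K n.+2.
  rewrite binom32S n2 n3; field; lra.
have H4 : binom32 K n.+4
    = (2 * n%:R + 1) * (2 * n%:R + 3) / (4 * (n%:R + 3) * (n%:R + 4))
      * binom32 K n.+2.
  rewrite binom32S H3 n3 n4; field; lra.
have Hl : 2 * (n%:R + 4) * cofactor6 r w tau n.+3 =
   ((n%:R + 2) / 2 * binom32 K n.+2) * oddq r w n
       - (2 * n%:R + 5) * (3 * r * cofactor6 r w tau n.+2)
       - (2 * n%:R + 2)
         * ((3 * r ^+ 2 - 3 / 4 * w) * cofactor6 r w tau n.+1)
       - (2 * n%:R - 1)
         * ((r ^+ 3 - 3 / 4 * r * w - tau / 4) * cofactor6 r w tau n).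
  rewrite cofactor6SSS n2; field; lra.
have n4_neq0 : 2 * (n%:R + 4) != 0 :> K by lra.
apply: (mulfI n4_neq0).
have -> : 2 * (n%:R + 4) * b n.+4 = 2 * (n.+1%:R + 3) * b n.+4.
  by rewrite n1; ring.
rewrite Hb P0 P1 P2 n1 H3 H4 !exprS.
have -> (e x y z : K) : 2 * (n%:R + 4) * (e * (x + y * z))
  = e * (2 * (n%:R + 4) * x + y * (2 * (n%:R + 4) * z)) by ring.
rewrite Hl /p1 /p2 /p3.
move: {Hl Hb P0 P1 P2 H3 H4} H2 Hc.
move: (binom32 K n.+2) (binom32 K n.+1) => d2 d1.
move: (cpoly r w tau n.+3) (cpoly r w tau n.+2) (cpoly r w tau n.+1)
  (cpoly r w tau n) => c3 c2 c1 c0.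
move: (cofactor6 r w tau n.+2) (cofactor6 r w tau n.+1)
  (cofactor6 r w tau n) => l2 l1 l0.
move: ((- 6^-1) ^+ n) (oddq r w n) n_ge0 n4_neq0 => e q.
move: (n%:R : K) => N N_ge0 N4 H2 Hc.
set lc := (X in X = _) in Hc; set rc := (X in _ = X) in Hc.
(* The difference of the two sides is a combination of [H2] and [Hc]: the first multiplier is the
   coefficient of [d1] divided by 2 N - 1, the second restores the factor cleared in [cpoly_rec]. *)
apply: subr0_eq; transitivity
  ((r ^+ 3 - 3 / 4 * r * w - tau / 4) / 216 * (- 6^-1 * e) * c0
     * ((2 * N - 1) * d1 - (- 2 * (N + 2) * d2))
   + (- 6^-1 * e) / 216 * d2 / (2 * (N + 3)) * (lc - rc)).
  rewrite /lc /rc; field; lra.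
by rewrite H2 Hc !subrr !mulr0 addr0.
Qed.

(** * Numerical factors and the identification of C_(n) *)

Lemma double_factorialSS (n : nat) :
  double_factorial n.+2 = (n.+2 * double_factorial n)%N.
Proof. by []. Qed.

(** With k = n + 3 the left side is binom(1/2, k - 1), because k binom(3/2, k) = (3/2) binom(1/2, k
    - 1). The double factorials are (2k - 5)!! and (2(k - 1))!!, and k = 3 is the least k with 2k -
    5 positive. *)
Lemma binom32_double_factorial (K : realType) (n : nat) :
  binom32 K n.+3 * (2 * n.+3%:R / 3) =
  (-1) ^+ n.+3 * ((double_factorial (2 * n + 1))%:R
                  / (double_factorial (2 * n + 4))%:R).
Proof.
have df_neq0 m : (double_factorial m)%:R != 0 :> K.
  rewrite pnatr_eq0 -lt0n.
  have [] : (0 < double_factorial m)%N /\ (0 < double_factorial m.+1)%N.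
    by elim: m => [//|m [? ?]]; split=> //; rewrite double_factorialSS muln_gt0.
  by [].
elim: n => [|n IHn]; first by rewrite !binom32S /=; field.
have -> : (2 * n.+1 + 1 = (2 * n + 1).+2)%N by lia.
have -> : (2 * n.+1 + 4 = (2 * n + 4).+2)%N by lia.
rewrite binom32S !double_factorialSS !natrM.
have -> : binom32 K n.+3
    = binom32 K n.+3 * (2 * n.+3%:R / 3) * (3 / (2 * n.+3%:R)).
  have : n.+3%:R != 0 :> K by rewrite pnatr_eq0.
  by move: (n.+3%:R : K) => N N_neq0; field; rewrite N_neq0.
rewrite IHn (exprS _ n.+3); move: ((-1) ^+ n.+3) => e.
have n3 : n.+4%:R = n.+3%:R + 1 :> K by rewrite natr1.
have e1 : (2 * n + 1).+2%:R = 2 * n.+3%:R - 3 :> K.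
  by rewrite -!natr1 natrD natrM; ring.
have e2 : (2 * n + 4).+2%:R = 2 * n.+3%:R :> K.
  by rewrite -!natr1 natrD natrM; ring.
rewrite e1 e2 n3.
have := ltr0Sn K n.+2.
move: (df_neq0 (2 * n + 4)%N) (n.+3%:R : K).
move: ((double_factorial (2 * n + 4))%:R : K) => D D_neq0 N N_gt0.
by field; rewrite D_neq0 /=; apply/andP; split; lra.
Qed.

(** The denominator has 2 where [C_expr] has 4, since the two conjugate summands there add up to
    twice [cpoly]. *)
Definition C_density (K : realType) (n : nat) (r s2 s3 : K) : K :=
  3 * (-1) ^+ n / (2 * 6 ^+ n * n%:R) * cpoly r (24 * s2) (288 * s3) n.-1.

Lemma is_C_density (K : realType) (n : nat) : is_C n.+1 (@C_density K n.+1).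
Proof.
split; first exact/densityZ/density_cpoly.
move=> r s2 s3 s2_gt0; rewrite /C_density /C_expr /=.
set s := Num.sqrt (24 * s2); set q := _ / _ `^ _.
have sE : s ^+ 2 = 24 * s2 by rewrite sqr_sqrtr //; lra.
(* The origin of the constant in tau: sqrt 6 * 24^(3/2) = 12 * 24 = 288. *)
have qE : q * s ^+ 3 = 288 * s3.
  have s2_ge0 := ltW s2_gt0.
  have v3 : s2 `^ (3 / 2) = Num.sqrt s2 ^+ 3.
    by rewrite mulrC powRrM powR12_sqrt // powR_mulrn // sqrtr_ge0.
  have v_neq0 : Num.sqrt s2 != 0 by rewrite sqrtr_eq0 -ltNge.
  have s6 : Num.sqrt 6 * Num.sqrt 24 = 12 :> K.
    rewrite -sqrtrM //; have -> : 6 * 24 = 12 ^+ 2 :> K by ring.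
    by rewrite sqrtr_sqr ger0_norm.
  have s24 : Num.sqrt 24 ^+ 2 = 24 :> K by rewrite sqr_sqrtr.
  rewrite /q /s sqrtrM // v3.
  transitivity (Num.sqrt 6 * Num.sqrt 24 * Num.sqrt 24 ^+ 2 * s3).
    by field.
  by rewrite s6 s24; ring.
have binomial_parts (x : K) m :
    (r + x) ^+ m = evenp r (x ^+ 2) m + x * oddp r (x ^+ 2) m.
  by elim: m => [|m IHm] /=; [ring | rewrite exprS IHm; ring].
rewrite binomial_parts -[r - s]/(r + - s) binomial_parts sqrrN.
rewrite -sE -qE /cpoly.
have Hq := oddqE r (s ^+ 2) n.
(* The summands are exchanged by s -> - s, q -> - q, so only the part even under this survives. The
   products of q with odd powers of s contain r B - N A, which the hypothesis turns into s^2 O. *)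
have E (A B O N : K) : s ^+ 2 * O = r * B - N * A ->
    (A + s * B) * (r - N * s) * (1 - q) + (A - s * B) * (r + N * s) * (1 + q)
    = 2 * (r * A - N * s ^+ 2 * B - q * s ^+ 3 * O).
  move=> H; apply: subr0_eq.
  transitivity (2 * q * s * (s ^+ 2 * O - (r * B - N * A))); first by ring.
  by rewrite H subrr mulr0.
rewrite mulNr (E _ _ (oddq r (s ^+ 2) n) n%:R Hq).
have : 6 ^+ n.+1 != 0 :> K by rewrite expf_neq0.
have : n.+1%:R != 0 :> K by rewrite pnatr_eq0.
move: (6 ^+ n.+1 : K) (n.+1%:R : K) ((-1) ^+ n.+1 : K) => a b c b_neq0 a_neq0.
by field; rewrite b_neq0 a_neq0.
Qed.

(** * The determinant and the Born-Infeld terms *)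

(** Conceptually, M - r/2 = Z - r/6 with Z traceless, so with u = 1 - r t / 6 the determinant is u^3
    - (s2 / 2) u t^2 + (s3 / 3) t^3. The proof compares entries. *)
Lemma det3_einstein (K : realType) (M : 'M[K]_3) (t : K) :
  let r := \tr M in let Z := M - (r / 3)%:M in
  let s2 := \tr (Z *m Z) in let s3 := \tr (Z *m Z *m Z) in
  \det (1%:M + t *: (M - (r / 2)%:M)) =
  1 - r / 2 * t + (r ^+ 2 / 12 - s2 / 2) * t ^+ 2
  + (- r ^+ 3 / 216 + r * s2 / 12 + s3 / 3) * t ^+ 3.
Proof.
move=> r Z s2 s3.
pose i0 : 'I_3 := ord0; pose i1 : 'I_3 := lift ord0 ord0.
pose i2 : 'I_3 := lift ord0 (lift ord0 ord0).
have E (B : 'M[K]_3) : \det B =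
  B i0 i0 * (B i1 i1 * B i2 i2 - B i1 i2 * B i2 i1)
  - B i0 i1 * (B i1 i0 * B i2 i2 - B i1 i2 * B i2 i0)
  + B i0 i2 * (B i1 i0 * B i2 i1 - B i1 i1 * B i2 i0).
  (* Indexing entries by naturals lets ordinals of equal value but different form be identified by
     computation, as [ring] needs. *)
  have [b Lb] : exists b : nat -> nat -> K, forall i j, B i j = b i j.
    by exists (fun i j => B (inord i) (inord j)) => i j; rewrite !inord_val.
  rewrite (expand_det_row _ i0) !big_ord_recl big_ord0 /cofactor.
  rewrite !(expand_det_row _ ord0) !big_ord_recl !big_ord0 /cofactor !det_mx11.
  rewrite !mxE !Lb /= /bump /=; ring.
rewrite E !mxE /=.
rewrite /s2 /s3 /mxtrace !big_ord_recl !big_ord0 !mxE.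
rewrite !big_ord_recl !big_ord0 !mxE !big_ord_recl !big_ord0 /Z !mxE.
rewrite /r /mxtrace !big_ord_recl !big_ord0 /=.
have [b Lb] : exists b : nat -> nat -> K, forall i j, M i j = b i j.
    by exists (fun i j => M (inord i) (inord j)) => i j; rewrite !inord_val.
rewrite !Lb /= /bump /=.
by field.
Qed.

(** Raising an index turns g into the identity, so the density of t Ric is the square root of a
    cubic in t, to which [sqrt_coef_eq] applies. *)
Lemma B_termE (K : realType) (n : nat) (g Ric : 'M[K]_3) : is_metric g ->
  let r := scalar_curvature g Ric in let w := 24 * S2 g Ric in
  let tau := 288 * S3 g Ric in
  B_term n.+1 g Ric =
  (- 6^-1) ^+ n.+1 * (binom32 K n.+1 * cpoly r w tau n
     + (tau ^+ 2 - w ^+ 3) * cofactor6 r w tau n).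
Proof.
move=> [_ g_unit] r w tau.
pose M := raise_index g Ric.
have raise_sub (A : 'M[K]_3) (a : K) :
    raise_index g (A - a *: g) = raise_index g A - a%:M.
  by rewrite /raise_index mulmxBl -scalemxAl mulmxV // scalemx1.
have raiseZ (a : K) (A : 'M[K]_3) :
    raise_index g (a *: A) = a *: raise_index g A.
  by rewrite /raise_index -scalemxAl.
have fE t : born_infeld g (t *: Ric) = Num.sqrt (1 + (- r / 2) * t
    + ((3 * r ^+ 2 - 3 / 4 * w) / 36) * t ^+ 2
    + (- (r ^+ 3 - 3 / 4 * r * w - tau / 4) / 216) * t ^+ 3).
  rewrite /born_infeld; congr Num.sqrt.
  have -> : raise_index g (einstein g (t *: Ric)) = t *: (M - (r / 2)%:M).
    rewrite /einstein raise_sub raiseZ /scalar_curvature raiseZ mxtraceZ.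
    by rewrite -/M scalerBr scale_scalar_mx mulrA.
  rewrite det3_einstein /w /tau /S2 /S3 /traceless_ricci raise_sub -/M.
  rewrite -/(scalar_curvature g Ric) -/r.
  by move: (\tr _) (\tr _) => a b; field.
have [b0 b1 b2 brec] := taylor_sqrt_cubic fE.
exact: (sqrt_coef_eq b0 b1 b2 brec).
Qed.

(** The factor 2 (n + 1) / 3 offsets the normalisation of [C_density]; 13824 = 24^3 = 288^2 / 6. *)
Lemma B_term_C (K : realType) (n : nat) (g Ric : 'M[K]_3) : is_metric g ->
  B_term n.+1 g Ric =
  binom32 K n.+1 * (2 * n.+1%:R / 3)
    * eval_density (C_density n.+1) g Ric
  + Y6 g Ric * eval_density (fun r s2 s3 => 13824 * (- 6^-1) ^+ n.+1
      * cofactor6 r (24 * s2) (288 * s3) n) g Ric.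
Proof.
move=> metric_g; rewrite B_termE // /eval_density /C_density /Y6 /=.
have -> : (- 6^-1) ^+ n.+1 = (-1) ^+ n.+1 / 6 ^+ n.+1 :> K.
  by rewrite [LHS]exprNn exprVn.
have : 6 ^+ n.+1 != 0 :> K by rewrite expf_neq0.
have : n.+1%:R != 0 :> K by rewrite pnatr_eq0.
move: (6 ^+ n.+1 : K) (n.+1%:R : K) ((-1) ^+ n.+1 : K) => a b c b_neq0 a_neq0.
by field; rewrite b_neq0 a_neq0.
Qed.

(** At 3 and 4 the source term contains [oddq] at 0 and 1, which is still zero. This makes the
    formulas for B_(1), ..., B_(5) exact. *)
Lemma cofactor6_lt5 (K : realType) (r w tau : K) (n : nat) :
  (n < 5)%N -> cofactor6 r w tau n = 0.
Proof.
by case: n => [|[|[|[|[|n]]]]] // _; rewrite !cofactor6SSS /=; ring.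
Qed.

Theorem mainTheorem14 (K : realType) :
  exists C : nat -> K -> K -> K -> K,
    (forall n : nat, (1 <= n)%N -> is_C n (C n)) /\
    (forall g Ric : 'M[K]_3, is_metric g -> Ric^T = Ric ->
      [/\ B_term 1 g Ric = eval_density (C 1%N) g Ric,
          B_term 2 g Ric = 1 / 2 * eval_density (C 2%N) g Ric,
          B_term 3 g Ric = - (1 / 8) * eval_density (C 3%N) g Ric,
          B_term 4 g Ric = 1 / 16 * eval_density (C 4%N) g Ric
        & B_term 5 g Ric = - (5 / 128) * eval_density (C 5%N) g Ric]) /\
    (forall n : nat, (6 <= n)%N ->
      exists L : K -> K -> K -> K,
        density_of_order (n - 6) L /\
        forall g Ric : 'M[K]_3, is_metric g -> Ric^T = Ric ->
          B_term n g Ric =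
            (-1) ^+ n
            * ((double_factorial (2 * n - 5))%:R
               / (double_factorial (2 * (n - 1)))%:R)
            * eval_density (C n) g Ric
            + Y6 g Ric * eval_density L g Ric).
Proof.
exists (@C_density K); split; first by case=> [//|n _]; apply: is_C_density.
split=> [g Ric metric_g _|n n_ge6].
  have low n : (n < 5)%N -> B_term n.+1 g Ric =
      binom32 K n.+1 * (2 * n.+1%:R / 3) * eval_density (C_density n.+1) g Ric.
    move=> n_lt5; rewrite B_term_C // /eval_density cofactor6_lt5 //.
    by rewrite !mulr0 addr0.
  by split; rewrite low // ?mul1r !binom32S /=; field.
have -> : n = (n - 6).+3.+3 by lia.
move: (n - 6)%N => {n n_ge6} m.
(* The cofactor of Y6 in [B_term_C] for n = m + 6; the entry m + 5 of [cofactor6] has order m + 5 +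
   1 - 6 = m. *)
exists (fun r s2 s3 => 13824 * (- 6^-1) ^+ m.+3.+3
      * cofactor6 r (24 * s2) (288 * s3) m.+3.+2).
split=> [|g Ric metric_g _].
  have -> : (m.+3.+3 - 6 = m)%N by lia.
  exact/densityZ/(density_from_order (k := 6))/density_cofactor6.
rewrite B_term_C // binom32_double_factorial.
have -> : (2 * m.+3.+3 - 5 = 2 * m.+3 + 1)%N by lia.
by have -> : (2 * (m.+3.+3 - 1) = 2 * m.+3 + 4)%N by lia.
Qed.
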